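(* Fix an integer $\ell\ge 3$. There exists $C>0$ such that for every $1\le m\le \frac{n}{64\ell^2}$ and every $n$-vertex graph $G$ with minimum degree $\delta(G)\ge m$, if $p\ge C\log n/n$ then asymptotically almost surely $G\cup G(n,p)$ contains $m$ pairwise vertex-disjoint copies of $C_\ell$.
   Context: $C_\ell$ is the cycle on $\ell$ vertices. $G(n,p)$ is the binomial random graph on $V(G)$ (each pair an edge independently with probability $p$), and $G\cup G(n,p)$ has as edge set the union of both edge sets. ''Asymptotically almost surely'' means with probability tending to $1$ as $n\to\infty$, for any sequences $m=m_n$, $G=G_n$ satisfying the hypotheses. *)

(* Defs.v *)
From HB Require Import structures.
From mathcomp Require Import all_boot all_order all_algebra.
From mathcomp Require Import all_classical all_reals all_analysis.
Set Implicit Arguments. Unset Strict Implicit. Unset Printing Implicit Defensive.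
Import Order.TTheory GRing.Theory Num.Theory.
Local Open Scope ring_scope.

(* Unordered pairs {i,j} of 'I_n, encoded as (i,j) with i < j. *)
Definition pairs (n : nat) : {set 'I_n * 'I_n} :=
  [set e : 'I_n * 'I_n | (e.1 < e.2)%N].

Definition simple_graph (n : nat) (G : rel 'I_n) : Prop :=
  symmetric G /\ irreflexive G.

Definition min_degree_ge (n : nat) (G : rel 'I_n) (m : nat) : Prop :=
  forall v : 'I_n, (m <= #|[set u | G v u]|)%N.

Definition union_adj (n : nat) (G : rel 'I_n) (S : {set 'I_n * 'I_n}) : rel 'I_n :=
  fun x y => (x != y) && [|| G x y, (x, y) \in S | (y, x) \in S].

Definition has_disjoint_cycles (n : nat) (adj : rel 'I_n) (m l : nat) : bool :=
  [exists F : {ffun 'I_m * 'I_l -> 'I_n},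
     injectiveb F &&
     [forall k : 'I_m, forall i : 'I_l, adj (F (k, i)) (F (k, ordS i))]].

(* Probability under G(n,p) (each pair an edge independently with prob. p)
   that G ∪ G(n,p) contains m vertex-disjoint copies of C_l. *)
Definition prob_union (R : realType) (n : nat) (G : rel 'I_n) (p : R) (m l : nat) : R :=
  \sum_(S in powerset (pairs n) | has_disjoint_cycles (union_adj G S) m l)
     p ^+ #|S| * (1 - p) ^+ (#|pairs n| - #|S|).

(* Main.v *)
Require Import Defs.
From HB Require Import structures.
From mathcomp Require Import all_boot all_order all_algebra.
From mathcomp Require Import all_classical all_reals all_analysis.
Import Order.TTheory GRing.Theory Num.Theory.
Import numFieldNormedType.Exports.
From mathcomp Require Import fintype finset zify ring lra.
Set Implicit Arguments. Unset Strict Implicit. Unset Printing Implicit Defensive.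
Local Open Scope ring_scope.

(* Call a vertex a hub if its degree in G is at least n / (8 l); let h be the
   number of hubs, and m' = m - h if h < m.  Almost surely two properties hold.
   (1) If h < m, then for every set I of at most l m' vertices there is an
   l-cycle that avoids I and the hubs.  (2) Every set of at least n / (16 l)
   vertices contains a path on l - 1 vertices.  Given both, choose cycles
   greedily: first m' cycles avoiding the hubs by (1), then close a path inside
   the unused neighbourhood of each hub by (2).

   For (1), the non-hubs outside I span at least m' n / 2 arcs (ordered
   adjacent pairs) of G: each of them has at least m' neighbours that are not
   hubs, and the non-hubs in I have degree below n / (8 l).  Removing the lightest
   vertices to serve as layers W_1, ..., W_(l-2) and cutting the rest into X and Y
   leaves a set P of at least m' n / 16 arcs from X to Y, and a cycle is closed
   by a random path from x
   through the layers to y for some (x, y) in P.  Such paths are found one layer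
   at a time: P is replaced by the pairs (w, y) with w in W_1 joined by a random
   edge to some x with (x, y) in P.  A Laplace transform estimate shows that P
   shrinks by at most a constant factor, except with probability
   n ^ (- K m'), where K grows with C; this survives the union bound over the
   n ^ (l m') choices of I.  For (2) the same argument applies to all pairs
   between two disjoint sets of linear size, with a failure probability that
   beats 2 ^ n. *)

(** The ground set [D] is arbitrary, not just [pairs n], so that disjoint groups of pairs can be
    exposed one after another. *)
Definition bern_expect (R : realType) (T : finType) (p : R) (D : {set T})
    (f : {set T} -> R) : R :=
  \sum_(S in powerset D) p ^+ #|S| * (1 - p) ^+ (#|D| - #|S|) * f S.

(** * Random subsets *)

Section BernoulliSubset.
Variables (R : realType) (T : finType) (p : R).
Implicit Types (D Q S : {set T}) (f g : {set T} -> R).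
Local Notation E := (bern_expect p).

(** Independence over disjoint ground sets: [S] corresponds bijectively to its traces on [D1] and
    [D2], and the weights multiply. Every exposure argument below rests on this identity. *)
Lemma bern_expect_split D1 D2 f : [disjoint D1 & D2] ->
  E (D1 :|: D2) f = E D1 (fun S1 => E D2 (fun S2 => f (S1 :|: S2))).
Proof.
move=> dD; rewrite /bern_expect.
under [RHS]eq_bigr => S1 _ do rewrite big_distrr /=.
rewrite pair_big_dep /=.
have capU (A B S1 S2 : {set T}) : [disjoint A & B] ->
    S1 \subset A -> S2 \subset B -> (S1 :|: S2) :&: A = S1.
  move=> dAB s1 s2; rewrite setIUl (setIidPl s1).
  have -> : S2 :&: A = set0; last by rewrite setU0.
  apply/eqP; rewrite setI_eq0 disjoint_sym.
  exact: disjointWr s2 dAB.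
rewrite (reindex_onto (fun u : {set T} * {set T} => u.1 :|: u.2)
                      (fun S => (S :&: D1, S :&: D2))) /=; last first.
  by move=> S; rewrite powersetE -setIUr => /setIidPl.
apply: eq_big => [[S1 S2]|[S1 S2]] /=.
  rewrite !powersetE; apply/andP/andP => [[s /eqP[<- <-]]|[s1 s2]].
    by rewrite !subsetIr.
  split; first exact: setUSS.
  by rewrite (capU _ _ _ _ dD) // setUC (capU D2 D1) // disjoint_sym.
rewrite powersetE => /andP[s /eqP[h1 h2]].
have s1 : S1 \subset D1 by rewrite -h1 subsetIr.
have s2 : S2 \subset D2 by rewrite -h2 subsetIr.
have d12 : [disjoint S1 & S2] by apply: disjointWl s1 (disjointWr s2 dD).
rewrite !cardsU (eqP (_ : S1 :&: S2 == set0)) ?setI_eq0 //.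
rewrite (eqP (_ : D1 :&: D2 == set0)) ?setI_eq0 // !cards0 !subn0.
have := subset_leq_card s1; have := subset_leq_card s2 => c2 c1.
rewrite (_ : (#|D1| + #|D2| - (#|S1| + #|S2|) =
              (#|D1| - #|S1|) + (#|D2| - #|S2|))%N); last by lia.
by rewrite !exprD; ring.
Qed.

Lemma bern_expect0 f : E set0 f = f set0.
Proof. by rewrite /bern_expect powerset0 big_set1 cards0 !expr0 !mul1r. Qed.

Lemma bern_expect1 e f : E [set e] f = p * f [set e] + (1 - p) * f set0.
Proof.
rewrite /bern_expect (_ : powerset [set e] = [set [set e]; set0]); last first.
  apply/setP => S; rewrite powersetE !inE.
  by rewrite subset1.
rewrite big_setU1 /=; last first.
  by rewrite !inE; apply/eqP => /setP/(_ e); rewrite !inE eqxx.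
by rewrite big_set1 cards0 cards1 subnn subn0 !expr0 !expr1 mulr1 mul1r.
Qed.

Lemma bern_expect_cst D c : E D (fun=> c) = c.
Proof.
have [k] := ubnP #|D|; elim: k D => // k IH D.
have [->|[e eD] kD] := set_0Vmem D; first by rewrite bern_expect0.
rewrite -(setD1K eD) bern_expect_split ?disjoints1 ?inE ?eqxx // bern_expect1.
have /IH -> : (#|D :\ e| < k)%N by move: kD; rewrite (cardsD1 e) eD.
ring.
Qed.

Hypothesis p01 : 0 <= p <= 1.

Lemma le_bern_expect D f g : (forall S, S \subset D -> f S <= g S) -> E D f <= E D g.
Proof.
move=> fg; apply: ler_sum => S; rewrite powersetE => sD.
apply: ler_wpM2l; last exact: fg.
by case/andP: p01 => p0 p1; rewrite mulr_ge0 // exprn_ge0 // subr_ge0.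
Qed.

Lemma bern_expectD D f g : E D (fun S => f S + g S) = E D f + E D g.
Proof. by rewrite /bern_expect -big_split /=; apply: eq_bigr => S _; rewrite mulrDr. Qed.

Lemma bern_expectZ D c f : E D (fun S => c * f S) = c * E D f.
Proof. by rewrite /bern_expect big_distrr /=; apply: eq_bigr => S _; rewrite mulrCA. Qed.

Lemma bern_expect_sum (I : finType) D (f : I -> {set T} -> R) :
  E D (fun S => \sum_i f i S) = \sum_i E D (f i).
Proof.
rewrite /bern_expect exchange_big /=; apply: eq_bigr => S _.
by rewrite big_distrr.
Qed.

(** Expose [Q] first: only the empty trace on [Q] contributes, and its weight is the right-hand
    side. *)
Lemma bern_expect_avoid D Q : Q \subset D ->
  E D (fun S => [disjoint Q & S]%:R) <= (1 - p) ^+ #|Q|.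
Proof.
move=> QD.
have {1}-> : D = Q :|: (D :\: Q).
  by rewrite -{1}(setID D Q) (setIidPr QD).
rewrite bern_expect_split; last by rewrite -setI_eq0 setIDA setD_eq0 subsetIl.
have h : forall S1, S1 \subset Q ->
   E (D :\: Q) (fun S2 => [disjoint Q & S1 :|: S2]%:R) <= (S1 == set0)%:R.
  move=> S1 s1; rewrite -[leRHS](bern_expect_cst (D :\: Q)).
  apply: le_bern_expect => S2 s2; rewrite ler_nat.
  case: (set_0Vmem S1) => [->|[x xS]]; first by rewrite eqxx leq_b1.
  rewrite (_ : [disjoint _ & _] = false) //.
  apply/negP => /pred0P/(_ x) /=; rewrite !inE xS /= andbT.
  by rewrite (subsetP s1).
apply: le_trans (le_bern_expect h) _.
rewrite /bern_expect (bigD1 set0) ?powersetE ?sub0set //= cards0 eqxx subn0.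
rewrite big1 ?addr0 ?expr0 ?mul1r ?mulr1 // => S /andP[_ /negbTE ->].
by rewrite mulr0.
Qed.
End BernoulliSubset.

(** * Random paths through layers *)

Section Layers.
Variables (n : nat).
Implicit Types (x y w : 'I_n) (X W : {set 'I_n}) (P S D : {set 'I_n * 'I_n}).

Definition edge x y : 'I_n * 'I_n := if (x < y)%N then (x, y) else (y, x).

Lemma edge_eq x y x' y' : edge x y = edge x' y' ->
  (x = x' /\ y = y') \/ (x = y' /\ y = x').
Proof.
by rewrite /edge; case: ifP; case: ifP => _ _ [-> ->]; [left|right|right|left].
Qed.

Definition ext S P W : {set 'I_n * 'I_n} :=
  [set q | (q.1 \in W) && [exists x, ((x, q.2) \in P) && (edge x q.1 \in S)]].

Lemma extP S P W w y :
  reflect (w \in W /\ exists2 x, (x, y) \in P & edge x w \in S)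
          ((w, y) \in ext S P W).
Proof.
rewrite inE /=; apply: (iffP andP) => -[wW].
  by move=> /existsP[x /andP[xP xS]]; split => //; exists x.
by case=> x xP xS; split => //; apply/existsP; exists x; rewrite xP.
Qed.

Lemma extS S S' P P' W : S \subset S' -> P \subset P' ->
  ext S P W \subset ext S' P' W.
Proof.
move=> sS sP; apply/subsetP => -[w y] /extP[wW [x xP xS]].
by apply/extP; split => //; exists x; [apply: (subsetP sP)|apply: (subsetP sS)].
Qed.

Lemma card_rows P : #|P| = (\sum_x #|[set y | (x, y) \in P]|)%N.
Proof.
rewrite -sum1_card (eq_bigl (fun q => true && ((q.1, q.2) \in P))); last first.
  by case.
rewrite -(pair_big_dep xpredT (fun x y => (x, y) \in P) (fun _ _ => 1%N)) /=.
by apply: eq_bigr => x _; rewrite -sum1_card; apply: eq_bigl => y; rewrite inE.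
Qed.

Variable (R : realType).

(** One exposure step: with probability [p] the edge is present and gains [d]; otherwise the [s]
    remaining pairs are used. Put [y = L d / k] and [a = L / k ^ 2], so that [a s <= y]. The factor
    2 in the first exponent supplies one [y] to absorb [a s] and one to gain from. After division by
    [expR (- (a s))] the left side is at most [1 - p y / (1 + L) <= 1 - y / k = 1 - a d]. *)
Lemma column_ineq (L p k s d : R) : 0 <= L -> 0 < k -> 0 <= d <= k ->
  0 <= s <= k * d -> (1 + L) / k <= p ->
  p * expR (- (2 * L / k * d)) + (1 - p) * expR (- (L / k ^+ 2 * s)) <=
  expR (- (L / k ^+ 2 * (s + d))).
Proof.
move=> L0 k0 /andP[d0 dk] /andP[s0 sd] pL.
set a := L / k ^+ 2; set y := L * d / k.
have a0 : 0 <= a by rewrite divr_ge0 // exprn_ge0 // ltW.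
have y0 : 0 <= y by rewrite divr_ge0 ?mulr_ge0 // ltW.
have yL : y <= L by rewrite ler_pdivrMr // ler_wpM2l.
have asy : a * s <= y.
  apply: le_trans (ler_wpM2l a0 sd) _.
  by rewrite le_eqVlt /a /y; apply/orP; left; apply/eqP; field; rewrite gt_eqF.
have -> : 2 * L / k * d = y + y by rewrite /y; field; rewrite gt_eqF.
have p0 : 0 <= p by apply: le_trans pL; rewrite divr_ge0 ?ltW //; lra.
rewrite mulrDr [in leRHS]opprD [in leRHS]expRD.
have -> : - (y + y) = - (a * s) + (a * s - (y + y)) by ring.
rewrite expRD mulrCA (mulrC (1 - p)) -mulrDr ler_pM2l ?expR_gt0 //.
have h1 : expR (a * s - (y + y)) <= expR (- y) by rewrite ler_expR; lra.
have h2 : expR (- y) <= 1 - y / (1 + L).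
  rewrite expRN; apply: (@le_trans _ _ (1 + y)^-1).
    by rewrite lef_pV2 ?posrE ?expR_gt0 ?expR_ge1Dx //; lra.
  have -> : (1 + y)^-1 = 1 - y / (1 + y) by field; lra.
  rewrite lerD2l lerN2 ler_wpM2l // lef_pV2 ?posrE; lra.
have h3 : y / k <= p * (y / (1 + L)).
  have -> : y / k = (1 + L) / k * (y / (1 + L)).
    by field; rewrite gt_eqF //=; lra.
  by rewrite ler_wpM2r // divr_ge0 //; lra.
have h4 : a * d = y / k by rewrite /a /y; field; rewrite gt_eqF.
have h5 := expR_ge1Dx (- (a * d)).
apply: le_trans h5; rewrite h4.
have h6 : p * expR (a * s - (y + y)) <= p * (1 - y / (1 + L)).
  by rewrite ler_wpM2l // (le_trans h1).
lra.
Qed.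

Variables (p L : R).
Hypothesis p01 : 0 <= p <= 1.
Hypothesis L0 : 0 <= L.
Hypothesis n0 : (0 < n)%N.
Hypothesis pL : (1 + L) / n%:R <= p.
Local Notation E := (bern_expect p).
Local Notation lam := (2 * L / n%:R).

Let nR : 0 < n%:R :> R. Proof. by rewrite ltr0n. Qed.
Let lam0 : 0 <= lam. Proof. by rewrite divr_ge0 ?mulr_ge0 // ltW. Qed.

Lemma expR_card_le (T : finType) (A B : {set T}) : A \subset B ->
  expR (- (lam * #|B|%:R)) <= expR (- (lam * #|A|%:R)).
Proof.
by move=> /subset_leq_card AB; rewrite ler_expR lerN2 ler_wpM2l // ler_nat.
Qed.

(* Expose the pairs at [w] in decreasing order of the degree in [P] of the
   other endpoint: the first edge present already contributes the maximum. *)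
Lemma ext1_laplace X P w D : (forall q, q \in P -> q.1 \in X) -> w \notin X ->
  (forall x, x \in X -> edge x w \in D) ->
  E D (fun S => expR (- (lam * #|ext S P [set w]|%:R))) <=
  expR (- (L / n%:R ^+ 2 * #|P|%:R)).
Proof.
have [k] := ubnP #|X|; elim: k X P D => // k IH X P D Xk PX wX XD.
have [X0|[x0 x0X]] := set_0Vmem X.
  have -> : P = set0.
    by apply/setP => q; rewrite inE; apply/negP => /PX; rewrite X0 inE.
  rewrite cards0 mulr0 oppr0 expR0 -[leRHS](bern_expect_cst p D).
  by apply: le_bern_expect => // S _; rewrite expR_le1 oppr_le0 mulr_ge0.
pose deg x := #|[set y | (x, y) \in P]|.
have [x xX xmax] : exists2 x, x \in X & forall x', x' \in X -> (deg x' <= deg x)%N.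
  by case: (@arg_maxnP _ x0 (mem X) deg) => // x; exists x.
pose P' := [set q in P | q.1 != x].
have cP : #|P| = (#|P'| + deg x)%N.
  rewrite [#|P|]card_rows [#|P'|]card_rows (bigD1 x) //= (bigD1 x (P := xpredT)) //=.
  rewrite [X in (X + _ + _)%N](_ : _ = 0%N); last first.
    by apply/eqP; rewrite cards_eq0; apply/eqP/setP => y; rewrite !inE eqxx andbF.
  rewrite add0n addnC; congr (_ + _)%N; apply: eq_bigr => z zx.
  by apply: eq_card => y; rewrite !inE zx andbT.
have cP' : (#|P'| <= n * deg x)%N.
  rewrite card_rows -[X in (X * _)%N]card_ord -sum_nat_const; apply: leq_sum => z _.
  case: (boolP (z \in X)) => zX.
    apply: leq_trans (xmax _ zX); apply: subset_leq_card.
    by apply/subsetP => y; rewrite !inE => /andP[].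
  rewrite (_ : finset _ = set0) ?cards0 //.
  apply/setP => y; rewrite !inE; apply/negP => /andP[/PX /=].
  by rewrite (negbTE zX).
have dn : (deg x <= n)%N by rewrite -[leqRHS]card_ord max_card.
set e := edge x w.
have eD : e \in D by exact: XD.
rewrite -(setD1K eD) bern_expect_split ?disjoints1 ?inE ?eqxx // bern_expect1.
have h1 : E (D :\ e) (fun S2 => expR (- (lam * #|ext ([set e] :|: S2) P [set w]|%:R)))
   <= expR (- (lam * (deg x)%:R)).
  rewrite -[leRHS](bern_expect_cst p (D :\ e)); apply: le_bern_expect => // S2 _.
  rewrite ler_expR lerN2 ler_wpM2l // ler_nat.
  rewrite /deg -(card_imset _ (f := fun y => (w, y))); last by move=> ? ? [].
  apply: subset_leq_card; apply/subsetP => _ /imsetP[y yP ->].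
  apply/(extP _ _ _ w y); split; first by rewrite inE.
  by exists x; [rewrite inE in yP|rewrite !inE eqxx].
have h2 : E (D :\ e) (fun S2 => expR (- (lam * #|ext (set0 :|: S2) P [set w]|%:R)))
   <= expR (- (L / n%:R ^+ 2 * #|P'|%:R)).
  have := IH (X :\ x) P' (D :\ e).
  rewrite (cardsD1 x X) xX /= ltnS in Xk; move=> /(_ Xk) H.
  apply: le_trans (H _ _ _).
  - apply: le_bern_expect => // S2 _; apply: expR_card_le.
    apply: extS; first by rewrite set0U.
    by apply/subsetP => q; rewrite inE => /andP[].
  - by move=> q; rewrite !inE => /andP[/PX -> ->].
  - by rewrite !inE negb_and wX orbT.
  - move=> z; rewrite !inE => /andP[zx zX]; rewrite XD // andbT.
    apply/eqP => /edge_eq[[zx']|[zw _]]; first by rewrite zx' eqxx in zx.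
    by rewrite zw (negbTE wX) in zX.
case/andP: p01 => p0 p1.
apply: le_trans (lerD (ler_wpM2l p0 h1) (ler_wpM2l (_ : 0 <= 1 - p) h2)) _.
  by rewrite subr_ge0.
rewrite cP natrD; apply: column_ineq => //; rewrite ?ler0n ?ler_nat //=.
by rewrite -natrM ler_nat.
Qed.

(** Distinct vertices of [W] use disjoint sets of random pairs, because [X] and [W] are disjoint,
    and they contribute disjoint parts of the extension. Hence the one-vertex bounds multiply. *)
Lemma ext_laplace X P W D : (forall q, q \in P -> q.1 \in X) ->
  [disjoint X & W] ->
  (forall x w, x \in X -> w \in W -> edge x w \in D) ->
  E D (fun S => expR (- (lam * #|ext S P W|%:R))) <=
  expR (- (L / n%:R ^+ 2 * #|P|%:R * #|W|%:R)).
Proof.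
have [k] := ubnP #|W|; elim: k W D => // k IH W D Wk PX XW XD.
have [->|[w wW]] := set_0Vmem W.
  rewrite cards0 mulr0 oppr0 expR0 -[leRHS](bern_expect_cst p D).
  by apply: le_bern_expect => // S _; rewrite expR_le1 oppr_le0 mulr_ge0.
have wX : w \notin X by rewrite disjoint_sym in XW; rewrite (disjointFr XW).
set D1 := [set edge x w | x in X].
have D1D : D1 \subset D by apply/subsetP => _ /imsetP[x xX ->]; exact: XD.
have DE : D = D1 :|: (D :\: D1).
  by rewrite -{1}(setID D D1) (setIidPr D1D).
rewrite {1}DE bern_expect_split; last first.
  by rewrite -setI_eq0 setIDA setD_eq0 subsetIl.
have h S1 S2 : expR (- (lam * #|ext (S1 :|: S2) P W|%:R)) <=
   expR (- (lam * #|ext S1 P [set w]|%:R)) * expR (- (lam * #|ext S2 P (W :\ w)|%:R)).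
  rewrite -expRD -opprD -mulrDr -natrD ler_expR lerN2 ler_wpM2l // ler_nat.
  rewrite -cardsUI (_ : _ :&: _ = set0) ?cards0 ?addn0; last first.
    apply/setP => -[v y]; rewrite !inE /=.
    by apply/negP => /andP[/andP[/eqP-> _]]; rewrite eqxx.
  apply: subset_leq_card; rewrite subUset; apply/andP; split; apply/subsetP.
    move=> [v y] /extP[/set1P-> [x xP xS]].
    by apply/extP; split => //; exists x; rewrite // inE xS.
  move=> [v y] /extP[/setD1P[_ vW] [x xP xS]].
  by apply/extP; split => //; exists x; rewrite // inE xS orbT.
apply: le_trans (le_bern_expect p01 (fun S1 _ => le_bern_expect p01 (fun S2 _ => h S1 S2))) _.
have hw := @ext1_laplace X P w D1 PX wX _.
have hW := IH (W :\ w) (D :\: D1) _ PX _ _.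
set b := E _ _ in hW.
rewrite (_ : E D1 _ = b * E D1 (fun S => expR (- (lam * #|ext S P [set w]|%:R)))); last first.
  by rewrite -bern_expectZ; congr bern_expect; apply/funext => S1; rewrite bern_expectZ mulrC.
rewrite (cardsD1 w W) wW natrD mulrDr mulr1 addrC opprD expRD.
apply: ler_pM.
- rewrite -(bern_expect_cst p (D :\: D1) 0); apply: le_bern_expect => // S _; exact: expR_ge0.
- rewrite -(bern_expect_cst p D1 0); apply: le_bern_expect => // S _; exact: expR_ge0.
- apply: hW.
  + by move: Wk; rewrite (cardsD1 w W) wW.
  + by apply: disjointWr XW; apply: subsetDl.
  + move=> x v xX; rewrite !inE => /andP[vw vW]; rewrite XD // andbT.
    apply/imsetP => -[x' x'X /edge_eq[[_ vw']|[xw _]]].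
      by rewrite vw' eqxx in vw.
    by rewrite xw (negbTE wX) in xX.
- by apply: hw => x xX; apply: imset_f.
Qed.

Variables (col : 'I_n -> nat).

Definition layer i : {set 'I_n} := [set v | col v == i].

(** Recursion on the number of layers still to cross lets the edges between two consecutive layers
    be exposed on their own; [hit_path] recovers the actual path. *)
Fixpoint hit S i j P : bool :=
  if j is j'.+1 then hit S i.+1 j' (ext S P (layer i.+1))
  else [exists q in P, edge q.1 q.2 \in S].

Lemma hitS S S' i j P P' : S \subset S' -> P \subset P' ->
  hit S i j P -> hit S' i j P'.
Proof.
move=> sS; elim: j i P P' => [|j IH] i P P' sP /=.
  move=> /exists_inP[q qP qS]; apply/exists_inP; exists q.
    exact: (subsetP sP).
  exact: (subsetP sS).
by apply: IH; apply: extS.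
Qed.

Lemma hit_path S i j P : hit S i j P ->
  exists x y ws, [/\ (x, y) \in P, map col ws = iota i.+1 j &
    path (fun a b => edge a b \in S) x (rcons ws y)].
Proof.
elim: j i P => [|j IH] i P /=.
  move=> /exists_inP[[x y] xP xS]; exists x, y, [::]; split => //=.
  by rewrite andbT.
move=> /IH[w [y [ws [/extP[]]]]]; rewrite inE => wi [x xP xS] wsc pw.
by exists x, y, (w :: ws); split => //=; rewrite ?wsc ?(eqP wi) ?xS.
Qed.

Variable (eps : R).
Hypothesis eps01 : 0 <= eps <= 1.

(** Induction on the number of layers. Each layer costs a factor [eps / 4] in the density [tau] and
    adds one failure term, which accounts for the factor [j.+1]. *)
Lemma hit_bound j i P D (tau : R) :
  (forall q, q \in P -> col q.1 = i /\ col q.2 = (i + j).+1) ->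
  (forall k, (i < k <= i + j)%N -> eps * n%:R <= #|layer k|%:R) ->
  (forall x y, (i <= col x <= i + j)%N -> col y = (col x).+1 -> edge x y \in D) ->
  0 <= tau -> n%:R * tau <= #|P|%:R ->
  E D (fun S => (~~ hit S i j P)%:R) <=
  j.+1%:R * expR (- (L * (eps / 4) ^+ j * tau)).
Proof.
case/andP: (eps01) => e0 e1.
elim: j i P D tau => [|j IH] i P D tau Pc Wc Dc tau0 Ptau.
  set Q := [set edge q.1 q.2 | q in P].
  have QD : Q \subset D.
    apply/subsetP => _ /imsetP[q /Pc[q1 q2] ->]; apply: Dc.
      by rewrite q1 addn0 leqnn.
    by rewrite q2 q1 addn0.
  (* The colours [i] and [i.+1] tell the two endpoints apart, so distinct pairs give distinct
     edges. *)
  have cQ : #|Q| = #|P|.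
    apply: card_in_imset => -[x y] [x' y'] /Pc/= [xc yc] /Pc/= [xc' yc'] /edge_eq.
    case=> [[-> ->] //|[xy _]]; move: xc; rewrite xy yc'; clear; lia.
  have h := bern_expect_avoid p01 QD.
  rewrite mul1r expr0 mulr1; apply: le_trans (_ : (1 - p) ^+ #|Q| <= _).
    apply: le_trans h; apply: le_bern_expect => // S _; rewrite ler_nat.
    case: (boolP [disjoint Q & S]) => [_|]; first exact: leq_b1.
    rewrite -setI_eq0 => /set0Pn[e]; rewrite inE => /andP[/imsetP[q qP ->] qS].
    rewrite (_ : hit _ _ _ _) //=; apply/exists_inP; by exists q.
  have [p0 p1] := andP p01.
  have e1p : 1 - p <= expR (- p) by have := expR_ge1Dx (- p).
  apply: le_trans (lerXn2r #|Q| _ _ e1p) _; rewrite ?nnegrE ?expR_ge0 ?subr_ge0 //.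
  rewrite -expRM_natl ler_expR cQ mulrN lerN2.
  apply: le_trans (_ : n%:R * tau * p <= _); last by rewrite ler_wpM2r.
  have : 1 + L <= p * n%:R by rewrite -ler_pdivrMr.
  move=> hL; have : L * tau <= p * n%:R * tau by apply: ler_wpM2r => //; lra.
  lra.
set W := layer i.+1; set X := layer i.
set D1 := edge @2: (X, W).
have D1D : D1 \subset D.
  apply/subsetP => e /imset2P[x w /[!inE] /eqP xi /eqP wi ->].
  by apply: Dc; rewrite ?xi ?wi // leqnn leq_addr.
have DE : D = D1 :|: (D :\: D1).
  by rewrite -{1}(setID D D1) (setIidPr D1D).
rewrite DE bern_expect_split; last first.
  by rewrite -setI_eq0 setIDA setD_eq0 subsetIl.
(* With this choice Markov's inequality costs [lam * (n * tau') = L * eps * tau / 2], half of the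
   exponent [L * eps * tau] supplied by [ext_laplace]. *)
set tau' := eps * tau / 4.
have tau'0 : 0 <= tau' by rewrite divr_ge0 ?mulr_ge0.
set B := j.+1%:R * expR (- (L * (eps / 4) ^+ j * tau')).
have B0 : 0 <= B by rewrite mulr_ge0 ?expR_ge0.
have XW : [disjoint X & W].
  by rewrite -setI_eq0; apply/eqP/setP => v; rewrite !inE; apply/negP => /andP[/eqP->]; rewrite ltn_eqF.
(* Either the extension is large and the induction hypothesis applies to the unexposed pairs, or the
   exponential term is at least 1 and bounds the probability trivially. *)
have h S1 : E (D :\: D1) (fun S2 => (~~ hit (S1 :|: S2) i j.+1 P)%:R) <=
   expR (lam * (n%:R * tau')) * expR (- (lam * #|ext S1 P W|%:R)) + B.
  have [big|small] := leP (n%:R * tau') #|ext S1 P W|%:R.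
    apply: (@le_trans _ _ B); last by rewrite lerDr mulr_ge0 ?expR_ge0.
    have := IH i.+1 (ext S1 P W) (D :\: D1) tau' _ _ _ tau'0 big.
    move=> H; apply: le_trans (H _ _ _).
    - apply: le_bern_expect => // S2 _; rewrite ler_nat.
      case: (boolP (hit S2 i.+1 j (ext S1 P W))) => hS2; last exact: leq_b1.
      rewrite (_ : hit (S1 :|: S2) _ _ _) //=.
      by apply: hitS hS2; [apply: subsetUr|apply: extS => //; apply: subsetUl].
    - move=> [w y] /extP[]; rewrite inE => /eqP /= wi [x /Pc[/= _ yc] _].
      by split => //; rewrite yc addSnnS.
    - by move=> k kk; apply: Wc; move: kk; clear; lia.
    - move=> x y xc yc; rewrite inE Dc ?andbT //; last by move: xc; clear; lia.
      apply/imset2P => -[x' w /[!inE] /eqP x'i /eqP wi /edge_eq].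
      by case=> -[xx yy]; subst; move: xc yc; rewrite ?x'i ?wi; clear; lia.
  apply: (@le_trans _ _ 1).
    rewrite -[leRHS](bern_expect_cst p (D :\: D1)); apply: le_bern_expect => // S2 _.
    by rewrite lern1 leq_b1.
  rewrite -expRD; apply: (@le_trans _ _ (expR 0 + 0)); first by rewrite expR0 addr0.
  by rewrite lerD // ler_expR -mulrBr mulr_ge0 // subr_ge0 ltW.
apply: le_trans (le_bern_expect p01 (fun S1 _ => h S1)) _.
rewrite bern_expectD bern_expect_cst bern_expectZ addrC (_ : j.+2%:R = j.+1%:R + 1); last by rewrite -natr1.
rewrite [leRHS]mulrDl [1 * _]mul1r.
apply: lerD.
  by rewrite /B exprS /tau' ler_wpM2l // ler_expR lerN2; rewrite le_eqVlt; apply/orP; left; apply/eqP; field.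
have M := @ext_laplace X P W D1 _ XW _.
apply: le_trans (ler_wpM2l (expR_ge0 _) (M _ _)) _.
- by move=> q /Pc[qi _]; rewrite inE qi.
- by move=> x w xX wW; apply/imset2P; exists x w.
rewrite -expRD ler_expR.
have cW : eps * n%:R <= #|W|%:R by apply: Wc; clear; lia.
have : L / n%:R ^+ 2 * (n%:R * tau) * (eps * n%:R) <= L / n%:R ^+ 2 * #|P|%:R * #|W|%:R.
  apply: ler_pM => //.
  - by rewrite !mulr_ge0 // invr_ge0 exprn_ge0.
  - by rewrite mulr_ge0.
  - by rewrite ler_wpM2l // divr_ge0 // exprn_ge0.
have -> : L / n%:R ^+ 2 * (n%:R * tau) * (eps * n%:R) = L * eps * tau.
  by field; rewrite gt_eqF.
have -> : lam * (n%:R * tau') = L * eps * tau / 2.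
  by rewrite /tau'; field; rewrite gt_eqF.
have : L * (eps / 4) ^+ j.+1 * tau <= L * eps * tau / 4.
  have : (eps / 4) ^+ j.+1 <= eps / 4.
    by rewrite exprS ler_piMr ?divr_ge0 // exprn_ile1 ?divr_ge0 //; lra.
  move=> h1; have h2 : 0 <= L * tau by rewrite mulr_ge0.
  have := ler_wpM2l h2 h1; lra.
have : 0 <= L * eps * tau by rewrite !mulr_ge0.
lra.
Qed.

End Layers.

(** * Layered cuts of a graph *)

Section FiniteChoices.
Variable T : finType.
Implicit Types (A B W X : {set T}).

(** Deleting a heaviest element never raises the average of [f]; start from [A] and delete down to
    size [s]. A constant [f] merely selects a subset of given size. *)
Lemma light_subset (f : T -> nat) A s : (s <= #|A|)%N ->
  exists W, [/\ W \subset A, #|W| = s &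
    (#|A| * \sum_(w in W) f w <= s * \sum_(w in A) f w)%N].
Proof.
move=> sA; have [k] := ubnPleq (#|A| - s)%N; elim: k s sA => [|k IH] s sA kA.
  have -> : s = #|A| by lia.
  by exists A.
have [->|ssA] := eqVneq s #|A|; first by exists A.
have [||W [WA cW hW]] := IH s.+1; try lia.
have [w0 w0W] : exists w0, w0 \in W.
  by apply/set0Pn; rewrite -cards_eq0 cW.
have [w wW wmax] : exists2 w, w \in W & forall v, v \in W -> (f v <= f w)%N.
  by case: (@arg_maxnP _ w0 (mem W) f) => // w; exists w.
exists (W :\ w); split.
- exact: subset_trans (subsetDl _ _) WA.
- by move: cW; rewrite (cardsD1 w) wW => -[].
rewrite -(leq_pmul2l (ltn0Sn s)).
have h : (\sum_(v in W) f v <= s.+1 * f w)%N.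
  by rewrite -cW -sum_nat_const; apply: leq_sum => v; exact: wmax.
move: h hW; rewrite (big_setD1 w) //=.
set a := f w; set b := \sum_(v in W :\ w) f v; set c := \sum_(v in A) f v => h hW.
nia.
Qed.

Lemma equal_layers W j s : (j * s <= #|W|)%N ->
  exists c : T -> nat, forall i, (i < j)%N -> (s <= #|[set v in W | c v == i]|)%N.
Proof.
elim: j W => [|j IH] W; first by exists (fun=> 0%N).
rewrite mulSn => jW.
have [|W' [WW' cW' _]] := @light_subset (fun=> 0%N) W s; first by lia.
have [|c hc] := IH (W :\: W').
  by have := cardsID W' W; rewrite (setIidPr WW') cW'; lia.
exists (fun v => if v \in W' then j else c v) => i; rewrite ltnS leq_eqVlt.
case/predU1P => [->|ij].
  rewrite -cW'; apply: subset_leq_card; apply/subsetP => v vW'.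
  by rewrite inE (subsetP WW') // vW' eqxx.
apply: leq_trans (hc i ij) _; apply: subset_leq_card; apply/subsetP => v.
by rewrite !inE => /andP[/andP[/negbTE-> ->]].
Qed.

Variable G : rel T.
Hypothesis Gsym : symmetric G.
Hypothesis Girr : irreflexive G.

Definition arcs (A B : {set T}) := (\sum_(x in A) \sum_(y in B) G x y)%N.

Lemma arcsC A B : arcs A B = arcs B A.
Proof.
rewrite /arcs exchange_big /=; apply: eq_bigr => x _; apply: eq_bigr => y _.
by rewrite Gsym.
Qed.

Lemma arcsUl A (A' B : {set T}) : [disjoint A & A'] -> arcs (A :|: A') B = (arcs A B + arcs A' B)%N.
Proof.
move=> d; rewrite /arcs -bigU //.
by apply: eq_bigl => x; rewrite !inE.
Qed.

Lemma arcsUr A B (B' : {set T}) : [disjoint B & B'] -> arcs A (B :|: B') = (arcs A B + arcs A B')%N.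
Proof. by move=> d; rewrite arcsC arcsUl // ![arcs _ A]arcsC. Qed.

(** Greedy cut: each new vertex joins the side where it has fewer neighbours, so half of the edges
    are cut. The other factor 2 arises because [arcs A A] counts every edge twice. *)
Lemma half_cut A : exists2 X : {set T}, X \subset A & (arcs A A <= 4 * arcs X (A :\: X))%N.
Proof.
suff [X XA h] : exists2 X : {set T}, X \subset A & (arcs A A <= 2 * (arcs X (A :\: X)).*2)%N.
  by exists X => //; lia.
have [k] := ubnP #|A|; elim: k A => // k IH A Ak.
have [->|[v vA]] := set_0Vmem A.
  by exists set0; rewrite ?sub0set // /arcs big_set0.
have [|X XA' hX] := IH (A :\ v); first by move: Ak; rewrite (cardsD1 v) vA.
set A' := A :\ v in XA' hX *; set Y := A' :\: X in hX.
have AE : A = [set v] :|: A' by rewrite setD1K.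
have A'E : A' = X :|: Y by rewrite -{1}(setID A' X) (setIidPr XA').
have vA' : v \notin A' by rewrite !inE eqxx.
have vX : v \notin X by apply: contra vA'; apply: (subsetP XA').
have vY : v \notin Y by apply: contra vA'; rewrite inE => /andP[].
have dXY : [disjoint X & Y] by rewrite -setI_eq0 setIDA setD_eq0 subsetIl.
have hA : (arcs A A = arcs A' A' + (arcs [set v] A').*2)%N.
  rewrite AE !(arcsUl, arcsUr) ?disjoints1 // (arcsC A' [set v]).
  by rewrite {1}/arcs !big_set1 Girr; lia.
have hv : arcs [set v] A' = (arcs [set v] X + arcs [set v] Y)%N.
  by rewrite {1}A'E arcsUr.
have [XY|YX] := leqP (arcs [set v] X) (arcs [set v] Y).
  exists ([set v] :|: X).
    by rewrite AE; apply: setUS.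
  have -> : A :\: ([set v] :|: X) = Y.
    by apply/setP => z; rewrite !inE; case: eqP => _ /=; rewrite ?andbF.
  by rewrite arcsUl ?disjoints1 //; lia.
exists X; first by apply: subset_trans XA' _; apply: subsetDl.
have -> : A :\: X = [set v] :|: Y.
  apply/setP => z; rewrite !inE; case: eqP => [->|] //=.
  by rewrite (negbTE vX) vA.
by rewrite arcsUr ?disjoints1 // (arcsC X [set v]); lia.
Qed.

(** The layers use the [j s] vertices of least degree inside [A], at most a quarter of [A]. At most
    a quarter of the arcs start there, so at most half meet the layers, and [half_cut] keeps a
    quarter of the rest. *)
Lemma layered_cut A j s : (4 * (j * s) <= #|A|)%N ->
  exists (col : T -> nat) (P : {set T * T}),
  [/\ forall q, q \in P -> [/\ col q.1 = 0%N, col q.2 = j.+1 & G q.1 q.2],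
      forall v, (col v <= j.+1)%N -> v \in A,
      forall i, (0 < i <= j)%N -> (s <= #|[set v | col v == i]|)%N &
      (arcs A A <= 8 * #|P|)%N].
Proof.
move=> jsA.
pose d x := (\sum_(y in A) G x y)%N.
have [|W [WA cW hW]] := @light_subset d A (j * s); first by lia.
have [|c hc] := @equal_layers W j s; first by rewrite cW.
set A0 := A :\: W.
have AE : A = W :|: A0 by rewrite -{1}(setID A W) (setIidPr WA).
have dWA : [disjoint W & A0] by rewrite -setI_eq0 setIDA setD_eq0 subsetIl.
have [X XA hX] := half_cut A0.
pose P := [set q : T * T | [&& q.1 \in X, q.2 \in A0 :\: X & G q.1 q.2]].
have cP : #|P| = arcs X (A0 :\: X).
  rewrite -sum1_card /arcs.
  rewrite (eq_bigl (fun q => (q.1 \in X) && ((q.2 \in A0 :\: X) && G q.1 q.2))); last first.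
    by move=> q; rewrite inE.
  rewrite -(pair_big_dep (mem X) (fun x y => (y \in A0 :\: X) && G x y) (fun _ _ => 1%N)) /=.
  by apply: eq_bigr => x _; rewrite big_mkcondr; apply: eq_bigr => y _; case: (G x y).
(* Start set 0, layers 1 to [j], end set [j.+1]; the value [j.+2] marks discarded vertices. *)
pose col v := if v \in W then (c v).+1 else if v \in X then 0%N
  else if v \in A0 then j.+1 else j.+2.
have colP v : v \in A0 -> v \notin W by rewrite inE => /andP[].
(* [equal_layers] does not bound its colours, so vertices of [W] coloured [j] or more are discarded
   as well. *)
exists (fun v => if (v \in W) && (j <= c v)%N then j.+2 else col v), P; split.
- move=> [x y]; rewrite inE /= => /and3P[xX /setDP[yA yX] ->].
  have /negbTE xW := colP _ (subsetP XA _ xX); have /negbTE yW := colP _ yA.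
  by rewrite /col xW yW xX (negbTE yX) yA.
- move=> v; rewrite /col; case: (boolP (v \in W)) => [vW|vW] /=.
    by move=> _; apply: (subsetP WA).
  case: (boolP (v \in X)) => [vX _|vX]; first by have := subsetP XA _ vX; rewrite inE => /andP[].
  by case: (boolP (v \in A0)) => [|_]; [rewrite inE => /andP[]|rewrite ltnn].
- move=> [|i] // /andP[_ ij]; apply: leq_trans (hc i ij) _.
  apply: subset_leq_card; apply/subsetP => v; rewrite !inE => /andP[vW /eqP ci].
  by rewrite vW ci leqNgt ij /= /col vW ci.
rewrite cP.
have hA : arcs A A = (arcs W A + arcs A0 W + arcs A0 A0)%N.
  by rewrite -addnA -(arcsUr A0) // -AE {1}AE arcsUl.
have hWA : arcs W A = (arcs W W + arcs A0 W)%N.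
  by rewrite (arcsC A0 W) -arcsUr // -AE.
have hd : (4 * arcs W A <= arcs A A)%N.
  have [js0|js0] := posnP (j * s)%N.
    have W0 : W = set0 by apply/eqP; rewrite -cards_eq0 cW js0.
    by rewrite W0 /arcs big_set0.
  rewrite -(leq_pmul2l js0).
  apply: leq_trans hW; rewrite mulnA; apply: leq_mul => //.
  by rewrite mulnC.
lia.
Qed.

End FiniteChoices.

(** * A single cycle or path *)

Section RandomCycles.
Variables (n : nat) (G : rel 'I_n).
Implicit Types (U Z : {set 'I_n}) (adj : rel 'I_n) (P S : {set 'I_n * 'I_n}).

Definition cycle_off adj l U : bool :=
  [exists c : l.-tuple 'I_n, [&& uniq c, cycle adj c & all [predC U] c]].

Definition path_in adj k Z : bool :=
  [exists c : k.-tuple 'I_n, [&& uniq c, sorted adj c & all [in Z] c]].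

Lemma edge_pairs (x y : 'I_n) : (edge x y \in pairs n) = (x != y).
Proof.
rewrite inE /edge -val_eqE /=.
by case: (ltngtP x y) => /= [->|->|->]; rewrite ?ltnn.
Qed.

Lemma edge_union_adj S (x y : 'I_n) : S \subset pairs n -> edge x y \in S ->
  union_adj G S x y.
Proof.
move=> sS exy; rewrite /union_adj -edge_pairs (subsetP sS) //=.
by move: exy; rewrite /edge; case: ifP => _ ->; rewrite !orbT.
Qed.

Lemma hit_layered_path S (col : 'I_n -> nat) j P : S \subset pairs n ->
  (forall q, q \in P -> col q.1 = 0%N /\ col q.2 = j.+1) ->
  hit col S 0 j P ->
  exists x y (c : seq 'I_n), [/\ (x, y) \in P, map col (x :: rcons c y) = iota 0 j.+2 &
    path (union_adj G S) x (rcons c y)].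
Proof.
move=> sS Pc /hit_path[x [y [c [xyP cc pc]]]]; exists x, y, c; split => //.
  have -> : iota 0 j.+2 = 0%N :: rcons (iota 1 j) j.+1.
    by rewrite -cats1 -(iotaD 1 j 1) addn1.
  by have [/= -> yc] := Pc _ xyP; rewrite map_rcons cc yc.
by apply: sub_path pc => a b; apply: edge_union_adj.
Qed.

Variables (R : realType) (p L eps : R).
Hypothesis p01 : 0 <= p <= 1.
Hypothesis L0 : 0 <= L.
Hypothesis n0 : (0 < n)%N.
Hypothesis pL : (1 + L) / n%:R <= p.
Hypothesis eps01 : 0 <= eps <= 1.
Local Notation E := (bern_expect p (pairs n)).

(** The two ends of the random path form an arc of [G], which closes the cycle. Its vertices are
    distinct because their colours are, and they avoid [U] because every used colour lies in the
    complement of [U]. *)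
Lemma cycle_off_bound U j s (tau : R) : symmetric G -> irreflexive G ->
  (4 * (j * s) <= #|~: U|)%N -> eps * n%:R <= s%:R -> 0 <= tau ->
  n%:R * tau * 8 <= (arcs G (~: U) (~: U))%:R ->
  E (fun S => (~~ cycle_off (union_adj G S) j.+2 U)%:R) <=
  j.+1%:R * expR (- (L * (eps / 4) ^+ j * tau)).
Proof.
move=> Gsym Girr jsU eps_s tau0 arcsU.
have [col [P [Pc cU sl cP]]] := layered_cut Gsym Girr jsU.
apply: le_trans (@hit_bound n R p L p01 L0 n0 pL col eps eps01 j 0 P (pairs n) tau _ _ _ tau0 _).
- apply: le_bern_expect => // S sS; rewrite ler_nat.
  case: (boolP (hit _ _ _ _ _)) => [hS|_]; last exact: leq_b1.
  have [|x [y [c [xyP cc pc]]]] := hit_layered_path sS _ hS.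
    by move=> q /Pc[].
  have sc : size (x :: rcons c y) == j.+2.
    by rewrite -(size_map col) cc size_iota.
  rewrite (_ : cycle_off _ _ _) //; apply/existsP; exists (Tuple sc).
  have uc : uniq (x :: rcons c y) by apply: (@map_uniq _ _ col); rewrite cc iota_uniq.
  apply/and3P; split => //.
    rewrite /= rcons_path pc last_rcons /union_adj Gsym.
    have [_ _ ->] := Pc _ xyP; rewrite orTb andbT.
    by move: uc => /= /andP[+ _]; rewrite mem_rcons inE negb_or eq_sym => /andP[].
  apply/allP => v vc /=; rewrite -in_setC; apply: cU.
  by have := map_f col vc; rewrite cc mem_iota add0n => /andP[].
- by move=> q /Pc[].
- by move=> k kj; apply: le_trans eps_s _; rewrite ler_nat; apply: sl.
- by move=> x y _ xy; rewrite edge_pairs; apply: contra_eq_neq xy => ->; rewrite ltn_eqF.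
- have : (arcs G (~: U) (~: U))%:R <= (8 * #|P|)%:R :> R by rewrite ler_nat.
  by rewrite natrM; lra.
Qed.

(** No closing edge is needed here, so all pairs between the first and the last layer may serve as
    targets: at least [s * s] of them. *)
Lemma path_in_bound Z j s (tau : R) :
  (j.+2 * s <= #|Z|)%N -> eps * n%:R <= s%:R -> 0 <= tau ->
  n%:R * tau <= (s * s)%:R ->
  E (fun S => (~~ path_in (union_adj G S) j.+2 Z)%:R) <=
  j.+1%:R * expR (- (L * (eps / 4) ^+ j * tau)).
Proof.
move=> sZ eps_s tau0 taus.
have [c hc] := equal_layers sZ.
pose col v := if v \in Z then c v else j.+2.
have hcol i : (i < j.+2)%N -> (s <= #|layer col i|)%N.
  move=> ij; apply: leq_trans (hc i ij) _; apply: subset_leq_card.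
  by apply/subsetP => v; rewrite !inE /col => /andP[-> ].
pose P := setX (layer col 0) (layer col j.+1).
have Pc q : q \in P -> col q.1 = 0%N /\ col q.2 = j.+1.
  by rewrite !inE => /andP[/eqP-> /eqP->].
apply: le_trans (@hit_bound n R p L p01 L0 n0 pL col eps eps01 j 0 P (pairs n) tau Pc _ _ tau0 _).
- apply: le_bern_expect => // S sS; rewrite ler_nat.
  case: (boolP (hit _ _ _ _ _)) => [hS|_]; last exact: leq_b1.
  have [x [y [w [xyP cc pc]]]] := hit_layered_path sS Pc hS.
  have sc : size (x :: rcons w y) == j.+2.
    by rewrite -(size_map col) cc size_iota.
  rewrite (_ : path_in _ _ _) //; apply/existsP; exists (Tuple sc).
  apply/and3P; split => //.
    by apply: (@map_uniq _ _ col); rewrite cc iota_uniq.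
  apply/allP => v vc /=.
  have := map_f col vc; rewrite cc mem_iota add0n /= /col.
  by case: ifP => // _; rewrite ltnn.
- move=> k kj; apply: le_trans eps_s _; rewrite ler_nat; apply: hcol.
  by case/andP: kj => _; rewrite add0n => /leq_ltn_trans; apply.
- by move=> x y _ xy; rewrite edge_pairs; apply: contra_eq_neq xy => ->; rewrite ltn_eqF.
- apply: le_trans taus _; rewrite ler_nat cardsX leq_mul //; exact: hcol.
Qed.

End RandomCycles.

(** * Disjoint cycles, deterministically *)

Section Greedy.
Variables (n l : nat) (adj : rel 'I_n).
Implicit Types (cs : seq (seq 'I_n)).

(** A duplicate-free concatenation says at once that each cycle is simple and that the cycles are
    disjoint. *)
Definition cycle_family cs : bool :=
  uniq (flatten cs) && all (fun c => (size c == l) && cycle adj c) cs.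

Lemma size_cycle_family cs : cycle_family cs -> size (flatten cs) = (size cs * l)%N.
Proof.
move=> /andP[_]; elim: cs => //= c cs IH /andP[/andP[/eqP sc _] /IH].
by rewrite size_cat sc mulSn => ->.
Qed.

Lemma cycle_family_cons cs (c : seq 'I_n) : cycle_family cs ->
  size c = l -> uniq c -> cycle adj c -> ~~ has [in flatten cs] c ->
  cycle_family (c :: cs).
Proof.
move=> /andP[ucs acs] sc uc cc hc; rewrite /cycle_family /= acs cc sc eqxx.
by rewrite cat_uniq uc ucs has_sym hc.
Qed.

Lemma uniq_flatten_nth cs i j (v : 'I_n) : uniq (flatten cs) ->
  v \in nth [::] cs i -> v \in nth [::] cs j -> i = j.
Proof.
elim: cs i j => [|c cs IH] [|i] [|j] //=; rewrite ?nth_nil ?in_nil //.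
- rewrite cat_uniq => /and3P[_ /hasPn h _] vc vj.
  have vf : v \in flatten cs.
    apply/flattenP; exists (nth [::] cs j) => //; apply: mem_nth.
    by rewrite ltnNge; apply/negP => jc; rewrite nth_default in vj.
  by have := h v vf; rewrite vc.
- rewrite cat_uniq => /and3P[_ /hasPn h _] vj vc.
  have vf : v \in flatten cs.
    apply/flattenP; exists (nth [::] cs i) => //; apply: mem_nth.
    by rewrite ltnNge; apply/negP => jc; rewrite nth_default in vj.
  by have := h v vf; rewrite vc.
- by rewrite cat_uniq => /and3P[_ _ u] vi vj; rewrite (IH i j).
Qed.

(** The index modulo the length matches [ordS] in [has_disjoint_cycles]. *)
Lemma cycle_nth (T : eqType) (e : rel T) (x0 : T) (c : seq T) i : (i < size c)%N ->
  cycle e c -> e (nth x0 c i) (nth x0 c (i.+1 %% size c)).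
Proof.
case: c => [|x c] // ic /(pathP x0)/(_ i); rewrite size_rcons => /(_ ic).
rewrite -rcons_cons nth_rcons /= ic nth_rcons.
move: ic; rewrite ltnS leq_eqVlt => /predU1P[->|ic].
  by rewrite ltnn eqxx modnn.
by rewrite ic modn_small.
Qed.

Lemma has_disjoint_cycles_family cs : (0 < l)%N -> (0 < size cs)%N ->
  cycle_family cs -> has_disjoint_cycles adj (size cs) l.
Proof.
move=> l0 cs0 fcs; have /andP[ucs /allP acs] := fcs.
have [v0 _] : exists v0 : 'I_n, true.
  have : (0 < size (flatten cs))%N by rewrite size_cycle_family // muln_gt0 cs0.
  by case: (flatten cs) => // v; exists v.
pose F (q : 'I_(size cs) * 'I_l) := nth v0 (nth [::] cs q.1) q.2.
have Fc (k : 'I_(size cs)) : nth [::] cs k \in cs by apply: mem_nth.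
have Fs (k : 'I_(size cs)) : size (nth [::] cs k) = l.
  by have /andP[/eqP] := acs _ (Fc k).
have Fin k i : F (k, i) \in nth [::] cs k by apply: mem_nth; rewrite Fs.
apply/existsP; exists [ffun q => F q]; apply/andP; split.
  apply/injectiveP => -[k i] [k' i']; rewrite !ffunE => FF.
  have kk' : k = k'.
    apply/val_inj/(uniq_flatten_nth ucs (Fin k i)).
    by rewrite FF.
  subst k'; congr pair; apply/val_inj/eqP.
  have uk : uniq (nth [::] cs k).
    move: ucs; rewrite -{1}(cat_take_drop k cs) (drop_nth [::]) // flatten_cat /=.
    by rewrite !cat_uniq => /and3P[_ _ /and3P[]].
  by rewrite -(nth_uniq v0 _ _ uk) ?Fs; [apply/eqP; exact: FF | exact: ltn_ord..].
apply/forallP => k; apply/forallP => i; rewrite !ffunE /F /=.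
have /andP[_ cc] := acs _ (Fc k).
by have := @cycle_nth _ adj v0 _ i _ cc; rewrite Fs; apply.
Qed.
End Greedy.

(** * Greedy choice of cycles around and away from the hubs *)

Section Deterministic.
Variables (n l m : nat) (G : rel 'I_n) (S : {set 'I_n * 'I_n}).
Local Notation adj := (union_adj G S).
Local Notation nbr v := [set u | G v u].

Definition hubs : {set 'I_n} := [set v | (n <= 8 * l * #|nbr v|)%N].

Hypothesis Gsimple : simple_graph G.
Hypothesis l3 : (3 <= l)%N.
Hypothesis mn : (64 * l ^ 2 * m <= n)%N.
Hypothesis m0 : (0 < m)%N.
Hypothesis pathS : forall Z : {set 'I_n}, (n <= 16 * l * #|Z|)%N -> path_in adj l.-1 Z.

Lemma adj_G v u : G v u -> adj v u.
Proof.
case: Gsimple => _ Girr Gvu; rewrite /union_adj Gvu andbT.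
by apply: contraTneq Gvu => ->; rewrite Girr.
Qed.

(** The initial family [cs] is arbitrary so that the lemma serves both when hub-free cycles come
    first and when the hubs alone suffice. *)
Lemma hub_cycles (hs : seq 'I_n) (cs : seq (seq 'I_n)) :
  cycle_family l adj cs -> uniq hs -> {subset hs <= hubs} ->
  {in hs, forall v, v \notin flatten cs} -> (size cs + size hs <= m)%N ->
  exists2 cs', cycle_family l adj cs' & size cs' = (size cs + size hs)%N.
Proof.
case: Gsimple => Gsym Girr.
elim: hs cs => [|h hs IH] cs fcs /=; first by exists cs; rewrite ?addn0.
move=> /andP[hhs uhs] hub hcs sm.
(* Hubs still waiting are excluded along with the used vertices. Together these are at most
   [l m <= n / (64 l)] vertices, so at least [n / (16 l)] neighbours of [h] remain. *)
pose Z := nbr h :\: [set u in flatten cs ++ hs].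
have hZ : (n <= 16 * l * #|Z|)%N.
  have hh : (n <= 8 * l * #|nbr h|)%N by have := hub h (mem_head _ _); rewrite inE.
  have h1 : (#|nbr h| <= #|Z| + l * m)%N.
    rewrite -(cardsID [set u in flatten cs ++ hs] (nbr h)) addnC leq_add2l.
    apply: leq_trans (subset_leq_card (subsetIr _ _)) _.
    rewrite cardsE; apply: leq_trans (card_size _) _.
    rewrite size_cat (size_cycle_family fcs).
    apply: leq_trans (leq_mul (leqnn l) sm); rewrite mulnDr mulnC leq_add2l.
    by apply: leq_trans (leqnSn _) _; rewrite leq_pmull // (leq_trans _ l3).
  have h2 : (16 * l * #|nbr h| <= 16 * l * #|Z| + 16 * (l ^ 2 * m))%N.
    by apply: leq_trans (leq_mul (leqnn (16 * l)) h1) _; rewrite mulnDr expnS expn1; clear; lia.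
  by move: hh h2 mn; set a := (l ^ 2 * m)%N; rewrite -mulnA -/a; clear; lia.
have /existsP[c /and3P[uc pc /allP cZ]] := pathS hZ.
have sc : size c = l.-1 by rewrite size_tuple.
have cZ' v : v \in (c : seq _) -> [/\ G h v, v \notin flatten cs & v \notin hs].
  move=> /cZ /=; rewrite !inE mem_cat negb_or => /andP[/andP[-> ->] ->]; by [].
have hc : h \notin (c : seq _) by apply/negP => /cZ'[]; rewrite Girr.
have fc : cycle_family l adj ((h :: c) :: cs).
  apply: cycle_family_cons => //.
  - by rewrite /= sc prednK // (leq_trans _ l3).
  - by rewrite /= hc.
  - move: sc pc cZ'; case: (tval c) => [|x c'] /=; first by case: (l) l3 => // -[|].
    move=> _ pc cG; rewrite rcons_path pc adj_G; last by have [] := cG x (mem_head _ _).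
    by rewrite adj_G // Gsym; have [] := cG _ (mem_last x c').
  - apply/hasPn => v; rewrite inE => /predU1P[->|/cZ'[]//].
    by apply: hcs; rewrite mem_head.
have [|||cs' fcs' scs'] := IH _ fc uhs.
- by move=> v vhs; apply: hub; rewrite inE vhs orbT.
- move=> v vhs /=; rewrite inE mem_cat !negb_or hcs ?inE ?vhs ?orbT // andbT.
  apply/andP; split; first by apply: contraNneq hhs => <-.
  by apply/negP => /cZ'[_ _]; rewrite vhs.
- by move: sm; rewrite /= addSnnS.
by exists cs' => //; rewrite scs' /= addSnnS.
Qed.

(** Forbidden sets are given as images of functions, which makes the count in the union bound a
    plain power of [n]. *)
Hypothesis cycleS : (#|hubs| < m)%N -> forall f : {ffun 'I_(l * (m - #|hubs|)) -> 'I_n},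
  cycle_off adj l (hubs :|: [set f i | i in 'I_(l * (m - #|hubs|))]).

Lemma light_cycles k : (k <= m - #|hubs|)%N ->
  exists cs, [/\ cycle_family l adj cs, size cs = k &
                 {in flatten cs, forall v, v \notin hubs}].
Proof.
elim: k => [_|k IH km]; first by exists [::].
have [cs [fcs scs csH]] := IH (ltnW km).
have [v0 _] : exists v0 : 'I_n, true.
  have n0 : (0 < n)%N by apply: leq_trans mn; rewrite !muln_gt0 m0 ?expn_gt0 (leq_trans _ l3).
  by exists (Ordinal n0).
have Hm : (#|hubs| < m)%N by rewrite -subn_gt0 (leq_ltn_trans _ km).
(* The image only has to cover the used vertices; padding with [v0] is harmless. *)
pose f := [ffun i : 'I_(l * (m - #|hubs|)) => nth v0 (flatten cs) i].
have /existsP[c /and3P[uc cc /allP cf]] := cycleS Hm f.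
have cf' v : v \in (c : seq _) -> (v \notin hubs) && (v \notin flatten cs).
  move=> /cf /=; rewrite inE negb_or => /andP[-> vf] /=.
  apply: contra vf => vcs.
  have iv : (index v (flatten cs) < l * (m - #|hubs|))%N.
    have : (index v (flatten cs) < size (flatten cs))%N by rewrite index_mem.
    rewrite (size_cycle_family fcs) scs => h; apply: leq_trans h _.
    by rewrite mulnC leq_mul2l (ltnW km) orbT.
  by apply/imsetP; exists (Ordinal iv) => //; rewrite ffunE /= nth_index.
exists (tval c :: cs); split => [||v].
- apply: cycle_family_cons => //; first by rewrite size_tuple.
  by apply/hasPn => v /cf'/andP[].
- by rewrite /= scs.
- by rewrite /= mem_cat => /orP[/cf'/andP[]|/csH].
Qed.

Lemma disjoint_cycles : has_disjoint_cycles adj m l.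
Proof.
suff [cs fcs sm] : exists2 cs, cycle_family l adj cs & size cs = m.
  by rewrite -sm; apply: has_disjoint_cycles_family; rewrite ?sm // (leq_trans _ l3).
have [Hm|Hm] := ltnP #|hubs| m.
  have [cs [fcs scs csH]] := light_cycles (leqnn _).
  have [|||cs' fcs' scs'] := @hub_cycles (enum hubs) cs fcs (enum_uniq _).
  - by move=> v; rewrite mem_enum.
  - by move=> v; rewrite mem_enum => vH; apply/negP => /csH; rewrite vH.
  - by rewrite scs -cardE subnK // ltnW.
  by exists cs' => //; rewrite scs' scs -cardE subnK // ltnW.
have st : size (take m (enum hubs)) = m by rewrite size_takel // -cardE.
have [||||cs' fcs' scs'] := @hub_cycles (take m (enum hubs)) [::] isT.
- by rewrite take_uniq // enum_uniq.
- by move=> v /mem_take; rewrite mem_enum.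
- by [].
- by rewrite st.
by exists cs' => //; rewrite scs' st.
Qed.

End Deterministic.

(** * Probability estimates *)

Section ManyArcs.
Variables (n l m : nat) (G : rel 'I_n).
Hypothesis Gsimple : simple_graph G.
Hypothesis l3 : (3 <= l)%N.
Hypothesis mn : (64 * l ^ 2 * m <= n)%N.
Hypothesis degG : min_degree_ge G m.
Hypothesis hubs_m : (#|hubs l G| < m)%N.
Variable I : {set 'I_n}.
Local Notation H := (hubs l G).
Hypothesis cI : (#|I| <= l * (m - #|H|))%N.
Local Notation V1 := (~: (H :|: I)).

Lemma card_remaining : (5 * n <= 8 * #|V1|)%N.
Proof.
have h1 : (#|H :|: I| <= l * m)%N.
  apply: leq_trans (leq_card_setU _ _) _.
  rewrite -[X in (_ <= l * X)%N](subnKC (ltnW hubs_m)) mulnDr leq_add //.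
  by rewrite leq_pmull // (leq_trans _ l3).
have h2 : (64 * (l * m) <= n)%N.
  apply: leq_trans mn; rewrite -mulnA leq_mul2l expnS expn1 -mulnA.
  by rewrite leq_mul2l leq_pmull ?orbT // (leq_trans _ l3).
have := cardsC (H :|: I); rewrite card_ord.
by move: h1 h2; clear; lia.
Qed.

(** Count non-hub neighbours from [V1]: at least [m'] each, over at least [5 n / 8] vertices. Those
    lost to [J] number at most [l m' * n / (8 l) = m' n / 8], as [J] contains no hub. What is left
    is at least [m' n / 2]. *)
Lemma many_arcs : (n * (m - #|H|) <= 2 * arcs G V1 V1)%N.
Proof.
case: Gsimple => Gsym Girr.
set m' := (m - #|H|)%N; set J := I :\: H.
have degE x (A : {set 'I_n}) : (\sum_(y in A) G x y = #|[set u in A | G x u]|)%N.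
  rewrite -sum1_card [RHS](eq_bigl (fun y => (y \in A) && G x y)); last by move=> y; rewrite inE.
  by rewrite big_mkcondr /=; apply: eq_bigr => y _; case: (G x y).
have h1 x : (m' <= \sum_(y in V1) G x y + \sum_(y in J) G x y)%N.
  rewrite /m' leq_subLR; apply: leq_trans (degG x) _.
  rewrite !degE; apply: (@leq_trans #|H :|: ([set u in V1 | G x u] :|: [set u in J | G x u])|).
    apply: subset_leq_card; apply/subsetP => u; rewrite inE => Gxu.
    by rewrite !in_setU !in_set Gxu; case: (_ <= _)%N; case: (u \in I).
  by rewrite (leq_trans (leq_card_setU _ _)) // leq_add2l leq_card_setU.
have h2 : (#|V1| * m' <= arcs G V1 V1 + arcs G J V1)%N.
  rewrite (arcsC Gsym J) -sum_nat_const /arcs -big_split /=.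
  by apply: leq_sum => x _; exact: h1.
have h3 : (8 * arcs G J V1 <= m' * n)%N.
  have l0 : (0 < l)%N by exact: leq_trans l3.
  rewrite -(leq_pmul2l l0).
  apply: (@leq_trans (\sum_(x in J) n)%N).
    rewrite mulnA (mulnC l) /arcs big_distrr /=; apply: leq_sum => x.
    rewrite in_setD inE -ltnNge => /andP[dx _]; apply: leq_trans (ltnW dx).
    rewrite leq_mul2l degE; apply/orP; right; apply: subset_leq_card.
    by apply/subsetP => u; rewrite !inE => /andP[].
  rewrite sum_nat_const mulnA leq_mul2r; apply/orP; right.
  by apply: leq_trans cI; apply: subset_leq_card; apply: subsetDl.
have h4 := card_remaining.
have h5 : (5 * n * m' <= 8 * (#|V1| * m'))%N.
  by rewrite mulnA leq_mul2r; apply/orP; right; move: h4; clear; lia.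
move: h2 h3 h5; set a := arcs G V1 V1; set b := arcs _ _ _; set c := (#|V1| * m')%N.
by rewrite (mulnC m') -mulnA; set d := (n * m')%N; clear; lia.
Qed.

End ManyArcs.

Lemma nat_exp_ln (R : realType) (n k : nat) : (0 < n)%N ->
  (n ^ k)%:R = expR (k%:R * ln n%:R) :> R.
Proof. by move=> n0; rewrite expRM_natl lnK ?posrE ?ltr0n // natrX. Qed.

Lemma card_set_type (T : finType) : #|{set T}| = (2 ^ #|T|)%N.
Proof. by rewrite -!cardsT -powersetT card_powerset. Qed.

Lemma ln_nat_ge1 (R : realType) (n : nat) : (4 <= n)%N -> 1 <= ln n%:R :> R.
Proof.
move=> n4; rewrite -ler_expR lnK ?posrE ?ltr0n ?(leq_trans _ n4) //.
apply: (@le_trans _ _ 4); last by rewrite (ler_nat _ 4).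
have h : 2^-1 <= expR (- 2^-1) :> R by have := expR_ge1Dx (- 2^-1 : R); lra.
have h1 : expR 2^-1 <= 2 :> R.
  by rewrite -[2^-1]opprK expRN -[leRHS]invrK lef_pV2 ?posrE ?expR_gt0 // invr_gt0.
have -> : 1 = 2^-1 + 2^-1 :> R by lra.
rewrite expRD; apply: le_trans (ler_pM _ _ h1 h1) _; rewrite ?expR_ge0 //; lra.
Qed.

Section Probability.
Variables (R : realType) (l : nat).
Hypothesis l3 : (3 <= l)%N.

(* The layers have [n %/ (16 * l ^ 2)] vertices; rounding down costs at most a
   factor [2]. *)
Definition layer_density : R := ((32 * l ^ 2)%N%:R)^-1.
Local Notation eps := layer_density.
(* Chosen so that the failure probabilities beat both union bounds, over the
   [n ^ (l * m')] forbidden sets and over the [2 ^ n] neighbourhoods. *)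
Definition edge_rate : R := 16 * l.+2%:R / (eps / 4) ^+ l.
Local Notation kap := edge_rate.

Let l0 : (0 < l)%N. Proof. exact: leq_trans l3. Qed.

Lemma layer_density_gt0 : 0 < eps.
Proof. by rewrite invr_gt0 ltr0n muln_gt0 expn_gt0 l0. Qed.

Lemma layer_density_le1 : eps <= 1.
Proof. by rewrite invf_le1 ?ltr0n ?ler1n muln_gt0 expn_gt0 l0. Qed.

Lemma edge_rate_gt0 : 0 < kap.
Proof.
rewrite /edge_rate divr_gt0 ?mulr_gt0 ?ltr0n ?exprn_gt0 //.
by rewrite divr_gt0 ?layer_density_gt0.
Qed.

(** The factor [c] pays for the powers of [eps / 4] not spent on layers: [c = 1] with [l - 2] layers
    for cycles, [c = eps ^+ 2] with [l - 3] for paths. *)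
Lemma edge_rateM j (c : R) : (j <= l)%N -> (eps / 4) ^+ (l - j) <= c ->
  16 * l.+2%:R <= kap * (eps / 4) ^+ j * c.
Proof.
move=> jl cl; have e0 : 0 < eps / 4 by rewrite divr_gt0 ?layer_density_gt0.
rewrite /edge_rate -[X in _ / _ ^+ X](subnK jl) exprD; set a := _ ^+ (l - j); set b := _ ^+ j.
have a0 : 0 < a by apply: exprn_gt0. have b0 : 0 < b by apply: exprn_gt0.
have -> : 16 * l.+2%:R / (a * b) * b * c = 16 * l.+2%:R * (c / a).
  by field; rewrite !gt_eqF.
by rewrite ler_peMr ?mulr_ge0 // ler_pdivlMr // mul1r.
Qed.

Variables (n m : nat) (G : rel 'I_n) (p : R).
Hypothesis Gsimple : simple_graph G.
Hypothesis mn : (64 * l ^ 2 * m <= n)%N.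
Hypothesis m0 : (0 < m)%N.
Hypothesis degG : min_degree_ge G m.
Hypothesis pC : (kap + 1) * ln n%:R / n%:R <= p.
Hypothesis p1 : p <= 1.
Local Notation H := (hubs l G).
Local Notation E := (bern_expect p (pairs n)).
Local Notation L := (kap * ln n%:R).
Local Notation s := (n %/ (16 * l ^ 2))%N.

Let n_big : (64 * l ^ 2 <= n)%N.
Proof. by apply: leq_trans mn; rewrite leq_pmulr. Qed.

Let n4 : (4 <= n)%N.
Proof. by apply: leq_trans n_big; rewrite (@leq_mul 4 1) // expn_gt0 l0. Qed.

Let n0 : (0 < n)%N. Proof. exact: leq_trans n4. Qed.
Let nR : 0 < n%:R :> R. Proof. by rewrite ltr0n. Qed.
Let ln1 : 1 <= ln n%:R :> R. Proof. exact: ln_nat_ge1. Qed.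
Let ln0 : 0 <= ln n%:R :> R. Proof. exact: le_trans ln1. Qed.
Let L0 : 0 <= L. Proof. by rewrite mulr_ge0 // ltW // edge_rate_gt0. Qed.

Let pL : (1 + L) / n%:R <= p.
Proof.
(* The summand 1 in [kap + 1] covers the 1 in [1 + L], since [ln n >= 1]. *)
apply: le_trans pC; rewrite ler_pM2r ?invr_gt0 //; move: ln1; lra.
Qed.

Let p01 : 0 <= p <= 1.
Proof. by rewrite p1 andbT; apply: le_trans pL; rewrite divr_ge0 ?addr_ge0. Qed.

Let eps01 : 0 <= eps <= 1.
Proof. by rewrite layer_density_le1 ltW // layer_density_gt0. Qed.

Let eps_s : eps * n%:R <= s%:R.
Proof.
have c0 : (0 < 16 * l ^ 2)%N by rewrite muln_gt0 expn_gt0 l0.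
rewrite mulrC ler_pdivrMr ?ltr0n ?muln_gt0 ?expn_gt0 ?l0 // -natrM ler_nat.
have s1 : (1 <= s)%N by rewrite divn_gt0 // (leq_trans _ n_big) // leq_mul2r orbT.
have := ltn_ceil n c0; set c := (16 * l ^ 2)%N.
rewrite (_ : 32 * l ^ 2 = 2 * c)%N; last by rewrite /c mulnA.
by move: s1; rewrite -/c; set t := (n %/ c)%N; clear; nia.
Qed.

Let sn : (16 * l * (l * s) <= n)%N.
Proof.
apply: leq_trans (leq_trunc_div n (16 * l ^ 2)); rewrite leq_eqVlt; apply/orP; left.
by apply/eqP; set t := (n %/ _)%N; rewrite expnS expn1; clear; nia.
Qed.

Lemma cycle_off_fails (I : {set 'I_n}) :
  (#|H| < m)%N -> (#|I| <= l * (m - #|H|))%N ->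
  E (fun S => (~~ cycle_off (union_adj G S) l (H :|: I))%:R) <=
  l%:R * expR (- ((l.+2 * (m - #|H|))%:R * ln n%:R)).
Proof.
move=> Hm cI; case: (Gsimple) => Gsym Girr.
have [j lj] : exists j, l = j.+2 by case: (l) l3 => [|[|j]] //; exists j.
set m' := (m - #|H|)%N.
(* [many_arcs] gives [n m' / 2] arcs, which is [8 n tau] for [tau = m' / 16]; the 16 in [edge_rate]
   cancels this denominator. *)
have hb := @cycle_off_bound n G R p L eps p01 L0 n0 pL eps01 (H :|: I) j s (m'%:R / 16).
apply: (@le_trans _ _ (j.+1%:R * expR (- (L * (eps / 4) ^+ j * (m'%:R / 16))))).
  rewrite {1}lj; apply: hb => //.
  - have h := card_remaining l3 mn Hm cI.
    have jl : (j <= l)%N by rewrite lj -addn2 leq_addr.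
    have h1 := leq_mul jl (leqnn s).
    have h2 : (16 * (l * s) <= n)%N.
      by apply: leq_trans sn; rewrite leq_mul2r leq_pmulr ?orbT.
    by move: h h1 h2; clear; lia.
  - have := many_arcs Gsimple l3 mn degG Hm cI.
    by rewrite -(ler_nat R) !natrM; lra.
apply: ler_pM; rewrite ?ler0n ?expR_ge0 //.
  by rewrite ler_nat lj.
rewrite ler_expR lerN2 natrM.
have := @edge_rateM j 1 _ _; rewrite mulr1 => /(_ _ _) h.
have {h} h : 16 * l.+2%:R <= kap * (eps / 4) ^+ j.
  apply: h; first by rewrite lj -addn2 leq_addr.
  have [e0 e1] := andP eps01.
  by rewrite exprn_ile1 ?divr_ge0 //; lra.
have h2 : 0 <= m'%:R * ln n%:R :> R by rewrite mulr_ge0.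
have := ler_wpM2l h2 h; lra.
Qed.

Lemma path_in_fails (Z : {set 'I_n}) : (n <= 16 * l * #|Z|)%N ->
  E (fun S => (~~ path_in (union_adj G S) l.-1 Z)%:R) <=
  l%:R * expR (- (2 * n%:R * ln n%:R)).
Proof.
move=> nZ.
have [j lj] : exists j, l = j.+3 by case: (l) l3 => [|[|[|j]]] //; exists j.
have [e0 e1] := andP eps01.
(* [s >= eps n] yields [s * s >= n tau] for [tau = eps ^+ 2 * n]. *)
have hb := @path_in_bound n G R p L eps p01 L0 n0 pL eps01 Z j s (eps ^+ 2 * n%:R).
apply: (@le_trans _ _ (j.+1%:R * expR (- (L * (eps / 4) ^+ j * (eps ^+ 2 * n%:R))))).
  rewrite {1}lj; apply: hb => //.
  - have jl : (j.+2 <= l)%N by rewrite lj leqnSn.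
    apply: leq_trans (leq_mul jl (leqnn s)) _.
    have : (16 * l * (l * s) <= 16 * l * #|Z|)%N by apply: leq_trans nZ.
    by rewrite leq_pmul2l // muln_gt0.
  - by rewrite mulr_ge0 ?exprn_ge0.
  - have -> : n%:R * (eps ^+ 2 * n%:R) = (eps * n%:R) * (eps * n%:R) by ring.
    by rewrite natrM ler_pM ?mulr_ge0.
apply: ler_pM; rewrite ?ler0n ?expR_ge0 //.
  by rewrite ler_nat lj (leq_trans (leqnSn _)).
rewrite ler_expR lerN2.
have h : 16 * l.+2%:R <= kap * (eps / 4) ^+ j * eps ^+ 2.
  apply: edge_rateM; first by rewrite lj -addn3 leq_addr.
  rewrite (_ : (l - j = 3)%N); last by rewrite lj -addn3 addKn.
  have -> : (eps / 4) ^+ 3 = eps ^+ 2 * (eps / 64) by field.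
  by rewrite ler_piMr ?exprn_ge0 //; lra.
have h1 : 2 <= kap * (eps / 4) ^+ j * eps ^+ 2.
  by apply: le_trans h; have : 0 <= l.+2%:R - 1 :> R; [rewrite subr_ge0 ler1n|lra].
have h2 : 0 <= n%:R * ln n%:R :> R by rewrite mulr_ge0.
have := ler_wpM2l h2 h1; lra.
Qed.

Lemma prob_union_ge : 1 - 2 * l%:R / n%:R <= prob_union G p m l.
Proof.
have -> : prob_union G p m l = E (fun S => (has_disjoint_cycles (union_adj G S) m l)%:R).
  rewrite /prob_union /bern_expect big_mkcondr; apply: eq_bigr => S _.
  by case: has_disjoint_cycles; rewrite ?mulr1 ?mulr0.
have E1 : E (fun S => (has_disjoint_cycles (union_adj G S) m l)%:R +
             (~~ has_disjoint_cycles (union_adj G S) m l)%:R) = 1.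
  rewrite -[RHS](bern_expect_cst p (pairs n)); congr bern_expect; apply/funext => S.
  by case: has_disjoint_cycles; rewrite ?addr0 ?add0r.
suff : E (fun S => (~~ has_disjoint_cycles (union_adj G S) m l)%:R) <= 2 * l%:R / n%:R.
  by move: E1; rewrite bern_expectD; lra.
set m' := (m - #|H|)%N; pose FT := {ffun 'I_(l * m') -> 'I_n}.
pose im (f : FT) := [set f i | i in 'I_(l * m')].
(* The size conditions are built into the indicators, so the union bounds can run over all functions
   and all sets. *)
pose badC (f : FT) S : R :=
  ((#|H| < m)%N && ~~ cycle_off (union_adj G S) l (H :|: im f))%:R.
pose badP (Z : {set 'I_n}) S : R :=
  ((n <= 16 * l * #|Z|)%N && ~~ path_in (union_adj G S) l.-1 Z)%:R.
have inv_n : n%:R^-1 = expR (- ln n%:R) :> R by rewrite expRN lnK ?posrE.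
have badCE f : E (badC f) <= l%:R * expR (- ((l * m')%:R * ln n%:R)) / n%:R.
  rewrite /badC; have [Hm|Hm] := ltnP #|H| m; last first.
    by rewrite bern_expect_cst divr_ge0 ?mulr_ge0 ?expR_ge0.
  apply: le_trans (cycle_off_fails Hm _) _.
    by apply: leq_trans (leq_imset_card _ _) _; rewrite card_ord.
  rewrite -[leRHS]mulrA ler_wpM2l // inv_n -expRD ler_expR -/m'.
  (* Of the exponent [l.+2 * m'], the part [l * m'] will cancel the number of functions, and one
     further unit supplies the factor [1 / n]. *)
  have : ((l * m').+1%:R <= (l.+2 * m')%:R :> R).
    have m'0 : (0 < m')%N by rewrite subn_gt0.
    by rewrite ler_nat; move: m'0; clear; lia.
  move=> h; have := ler_wpM2r ln0 h; rewrite -natr1; lra.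
have badPE Z : E (badP Z) <= l%:R * expR (- (n%:R * ln n%:R)) / n%:R.
  rewrite /badP; have [nZ|nZ] := leqP n (16 * l * #|Z|)%N; last first.
    by rewrite bern_expect_cst divr_ge0 ?mulr_ge0 ?expR_ge0.
  apply: le_trans (path_in_fails nZ) _.
  rewrite -[leRHS]mulrA ler_wpM2l // inv_n -expRD ler_expR.
  have h : 1 <= n%:R :> R by rewrite ler1n.
  have := ler_wpM2r ln0 h; lra.
have bad S : (~~ has_disjoint_cycles (union_adj G S) m l)%:R <=
    \sum_f badC f S + \sum_Z badP Z S.
  have sC : 0 <= \sum_f badC f S by apply: sumr_ge0 => f _; apply: ler0n.
  have sP : 0 <= \sum_Z badP Z S by apply: sumr_ge0 => f _; apply: ler0n.
  have [_|nh] := boolP (has_disjoint_cycles _ _ _); first by rewrite addr_ge0.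
  have [[f hf]|noC] := pselect (exists f, badC f S = 1).
    rewrite (bigD1 f) //= hf -!addrA lerDl; apply: addr_ge0 => //.
    by apply: sumr_ge0 => g _; apply: ler0n.
  have [[Z hZ]|noP] := pselect (exists Z, badP Z S = 1).
    rewrite [X in _ + X](bigD1 Z) //= hZ addrCA lerDl; apply: addr_ge0 => //.
    by apply: sumr_ge0 => g _; apply: ler0n.
  case/negP: nh; apply: disjoint_cycles => //.
    move=> Z nZ; have [//|hZ] := boolP (path_in _ _ Z); case: noP; exists Z.
    by rewrite /badP nZ hZ.
  move=> Hm f; have [//|hf] := boolP (cycle_off _ _ _); case: noC; exists f.
  by rewrite /badC Hm hf.
apply: le_trans (le_bern_expect p01 (fun S _ => bad S)) _.
rewrite bern_expectD !bern_expect_sum.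
have hC : \sum_f E (badC f) <= l%:R / n%:R.
  apply: le_trans (ler_sum _ (fun f _ => badCE f)) _.
  rewrite sumr_const card_ffun !card_ord -[leLHS]mulr_natl (nat_exp_ln _ _ n0).
  set a := _ * ln _; rewrite (_ : _ * _ = l%:R / n%:R * (expR a * expR (- a))); last by ring.
  by rewrite expRxMexpNx_1 mulr1.
have hP : \sum_Z E (badP Z) <= l%:R / n%:R.
  apply: le_trans (ler_sum _ (fun f _ => badPE f)) _.
  rewrite sumr_const card_set_type card_ord -[leLHS]mulr_natl.
  (* Bounding [2 ^ n] by [n ^ n] makes the cancellation the same as for cycles. *)
  apply: (@le_trans _ _ ((n ^ n)%:R * (l%:R * expR (- (n%:R * ln n%:R)) / n%:R))).
    rewrite ler_wpM2r ?divr_ge0 ?mulr_ge0 ?expR_ge0 // ler_nat.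
    by rewrite leq_exp2r // (leq_trans _ n4).
  rewrite (nat_exp_ln _ _ n0); set a := _ * ln _.
  rewrite (_ : _ * _ = l%:R / n%:R * (expR a * expR (- a))); last by ring.
  by rewrite expRxMexpNx_1 mulr1.
have -> : 2 * l%:R / n%:R = l%:R / n%:R + l%:R / n%:R :> R by field; rewrite gt_eqF.
exact: lerD.
Qed.

Lemma prob_union_le1 : prob_union G p m l <= 1.
Proof.
rewrite -[leRHS](bern_expect_cst p (pairs n)) /prob_union big_mkcondr.
have [p0 _] := andP p01.
apply: ler_sum => S _; case: ifP => _; first by rewrite mulr1.
by rewrite mulr1 mulr_ge0 ?exprn_ge0 ?subr_ge0.
Qed.

End Probability.

(** * Passage to the limit *)

Local Open Scope classical_set_scope.
Local Open Scope ring_scope.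

Theorem theorem1p6 (R : realType) (l : nat) : (3 <= l)%N ->
  exists C : R, 0 < C /\
    forall (m : nat -> nat) (G : forall n : nat, rel 'I_n) (p : nat -> R),
      (exists N : nat, forall n : nat, (N <= n)%N ->
         (1 <= m n)%N /\
         ((m n)%:R : R) <= n%:R / (64 * l ^ 2)%N%:R /\
         simple_graph (G n) /\
         min_degree_ge (G n) (m n) /\
         C * ln (n%:R) / n%:R <= p n /\ p n <= 1) ->
      prob_union (G n) (p n) (m n) l @[n --> \oo] --> (1 : R).
Proof.
move=> l3; exists (edge_rate R l + 1); split.
  by rewrite addr_gt0 ?edge_rate_gt0.
move=> m G p [N hN].
have bounds n : (N <= n)%N -> 1 - 2 * l%:R / n%:R <= prob_union (G n) (p n) (m n) l <= 1.
  move=> /hN[m0 [mn [Gs [Gd [pC p1]]]]].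
  have mn' : (64 * l ^ 2 * m n <= n)%N.
    move: mn; rewrite ler_pdivlMr ?ltr0n ?muln_gt0 ?expn_gt0 ?(leq_trans _ l3) //.
    by rewrite -natrM ler_nat mulnC.
  by rewrite prob_union_ge // prob_union_le1.
have cvg0 : (n%:R^-1 : R) @[n --> \oo] --> (0 : R).
  rewrite -(cvg_shiftS (fun n => (n%:R^-1 : R))); exact: cvg_harmonic.
have cvg1 : (1 - 2 * l%:R / n%:R : R) @[n --> \oo] --> (1 : R).
  rewrite -[X in _ --> X]subr0 -(mulr0 (2 * l%:R)).
  by apply: cvgB; [exact: cvg_cst|apply: cvgMr].
(* The failure probability is at most [2 l / n], whatever the sequences [m], [G] and [p]. *)
apply: (squeeze_cvgr _ cvg1 (cvg_cst (1 : R))).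
by near=> n; apply: bounds; near: n; exists N.
Unshelve. all: by end_near.
Qed.
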